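(* Let $p\ge 5$ be prime and let $G$ be a primitive but not $2$-fold transitive permutation group of degree $3p$. If $G$ is of Type III, then $p=3a^2+3a+1$ for some integer $a$, and the subdegrees of $G$ are either (i) $1,\ p-2a-1,\ 2p+2a$; or (ii) $1,\ p+2a+1,\ 2p-2a-2$.
   Context: Let $\pi$ denote the (complex) permutation character of $G$. $G$ is of Type III if $\pi=1_G+\chi_1+\chi_2$ where $\chi_1,\chi_2$ are distinct irreducible characters of $G$ of degrees $\deg\chi_1=2p$ and $\deg\chi_2=p-1$. The subdegrees of $G$ are the lengths of the orbits (suborbits) of a point stabiliser. *)

(* Defs.v *)
From mathcomp Require Import all_boot all_order all_algebra all_fingroup.
From mathcomp Require Import all_solvable all_field all_character.

Set Implicit Arguments.
Unset Strict Implicit.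
Unset Printing Implicit Defensive.

Import GRing.Theory.
Local Open Scope ring_scope.

Section PermutationGroup.

Variables (T : finType) (G : {group {perm T}}).

Fact perm_char_subproof :
  is_class_fun <<G>>%g [ffun g : {perm T} => #|('Fix_'P[g])%g|%:R *+ (g \in G)].
Proof.
rewrite genGid; apply: intro_class_fun => [g h Gg Gh | g /negbTE-> //].
rewrite groupJ // Gg; congr (_%:R *+ _).
rewrite -[RHS](card_imset _ (@perm_inj _ h)); apply: eq_card => y.
apply/afix1P/imsetP => /= [|[x /afix1P]]; rewrite /aperm /=.
  rewrite conjgE !permM => fy; exists (h^-1%g y); last by rewrite permKV.
  by apply/afix1P; apply: (@perm_inj _ h); rewrite /= /aperm fy permKV.
by move=> fx ->; rewrite conjgE !permM permK -[in RHS]fx.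
Qed.

(* Complex characters are class functions with values in algC, since they only
   take algebraic values; the factor (g \in G) is the extension by 0 that
   'CF(G) requires. *)
Definition perm_char : 'CF(G) := Cfun 0 perm_char_subproof.

Definition type_III (p : nat) : Prop :=
  exists i j : Iirr G,
    [/\ i != j, 'chi_i 1%g = (2 * p)%:R, 'chi_j 1%g = (p - 1)%:R
      & perm_char = 1 + 'chi_i + 'chi_j].

(* The sizes of the orbits of the stabiliser of x, each orbit counted once, so
   that equal sizes are repeated. *)
Definition suborbit_sizes (x : T) : seq nat :=
  [seq #|B| | B : {set T} in orbit 'P 'C_G[x | 'P]%g @: [set: T]].

(* The values are compared as integers, so that they may be given by
   expressions involving integer subtraction. *)
Definition has_subdegrees (s : seq int) : Prop :=
  forall x : T, perm_eq [seq n%:Z | n <- suborbit_sizes x] s.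

End PermutationGroup.

(* Main.v *)
(* Let A be the 0-1 matrix of the orbital of a nontrivial suborbit of minimal
   size k.  By Maschke and Schur, the constituents of the permutation character
   having distinct degrees 1, 2p, p - 1, A is similar to
   diag(k, c1 I_2p, c2 I_(p-1)).  The traces of A, A^2 and A^3 determine c1 and
   c2 by a rational formula, so c1 and c2 are rational integers and are also the
   eigenvalues of the transpose of A.  Then tr A = 0 and tr (A A^T) = 3pk yield,
   for m = - (2 c1 + c2), the equations k = m (p - 1) - 2 c1 and
   m (3 - m) (p - 1) = 6 c1 (c1 + 1).  Hence 0 <= m <= 3.  As 0 < 2k < 3p, the
   extreme values of m force k = 2, which makes a point stabiliser have order 2
   by primitivity and leaves no room for a suborbit of size 3p - 3; m = 1 and
   m = 2 give (i) and (ii) with a = c1. *)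
Require Import Defs.
From mathcomp Require Import all_boot all_order all_algebra all_fingroup.
From mathcomp Require Import all_solvable all_field all_character.
From mathcomp Require Import ring zify.

Set Implicit Arguments.
Unset Strict Implicit.
Unset Printing Implicit Defensive.

Import Order.TTheory GRing.Theory Num.Theory GroupScope.
Local Open Scope ring_scope.

(** * Schur's lemma and centralisers of sums of irreducible representations *)

Section Intertwiners.

Variables (gT : finGroupType) (G : {group gT}).

Definition dadd_repr n1 n2 (r1 : mx_representation algC G n1)
    (r2 : mx_representation algC G n2) : mx_representation algC G (n1 + n2) :=
  dadd_grepr (Representation r1) (Representation r2).

Lemma dadd_reprE n1 n2 (r1 : mx_representation algC G n1)
    (r2 : mx_representation algC G n2) g :
  dadd_repr r1 r2 g = block_mx (r1 g) 0 0 (r2 g).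
Proof. by []. Qed.

Lemma cfRepr_dadd_repr n1 n2 (r1 : mx_representation algC G n1)
    (r2 : mx_representation algC G n2) :
  cfRepr (dadd_repr r1 r2) = cfRepr r1 + cfRepr r2.
Proof. exact: (cfRepr_dadd (Representation r1) (Representation r2)). Qed.

(** The intertwining space of [r1] and [r2] is zero, so they share no constituent. *)
Definition disjoint_reprs n1 n2 (r1 : mx_representation algC G n1)
    (r2 : mx_representation algC G n2) : Prop :=
  forall M : 'M_(n1, n2), {in G, forall g, r1 g *m M = M *m r2 g} -> M = 0.

(** Schur's lemma: the image and the kernel of an intertwiner are submodules, so a nonzero one is
    invertible, hence square. Comparing degrees suffices here because the three constituents have
    distinct degrees. *)
Lemma disjoint_irr n1 n2 (r1 : mx_representation algC G n1)
    (r2 : mx_representation algC G n2) :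
  mx_irreducible r1 -> mx_irreducible r2 -> n1 != n2 -> disjoint_reprs r1 r2.
Proof.
move=> /mx_irrP[_ irr1] /mx_irrP[_ irr2] ne M cM.
apply: contraNeq ne => nzM.
have fullM : row_full M.
  rewrite -sub1mx -(genmxE M) sub1mx.
  apply: irr2; last by rewrite (eqmx_eq0 (genmxE M)).
  apply/mxmoduleP => g Gg.
  by rewrite (eqmxMr _ (genmxE M)) !genmxE -cM // submxMl.
have freeM : row_free M.
  rewrite -kermx_eq0; apply: contraT => nzK.
  have /irr1/(_ nzK) : mxmodule r1 (kermx M).
    apply/mxmoduleP => g Gg; apply/sub_kermxP.
    by rewrite -mulmxA cM // mulmxA mulmx_ker mul0mx.
  rewrite -sub1mx => /sub_kermxP; rewrite mul1mx => M0.
  by rewrite M0 eqxx in nzM.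
by move: freeM fullM; rewrite /row_free /row_full => /eqP->.
Qed.

Lemma disjoint_daddl n1 n2 n3 (r1 : mx_representation algC G n1)
    (r2 : mx_representation algC G n2) (r3 : mx_representation algC G n3) :
  disjoint_reprs r1 r3 -> disjoint_reprs r2 r3 ->
  disjoint_reprs (dadd_repr r1 r2) r3.
Proof.
move=> d1 d2 M cM.
have {}cM g : g \in G -> r1 g *m usubmx M = usubmx M *m r3 g /\
                         r2 g *m dsubmx M = dsubmx M *m r3 g.
  move/cM; rewrite -{1 2}[M]vsubmxK dadd_reprE mul_block_col mul_col_mx.
  by rewrite !mul0mx addr0 add0r => /eq_col_mx.
have u0 : usubmx M = 0 by apply: d1 => g /cM[].
have v0 : dsubmx M = 0 by apply: d2 => g /cM[].
by rewrite -[M]vsubmxK u0 v0 col_mx0.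
Qed.

Lemma disjoint_daddr n1 n2 n3 (r1 : mx_representation algC G n1)
    (r2 : mx_representation algC G n2) (r3 : mx_representation algC G n3) :
  disjoint_reprs r3 r1 -> disjoint_reprs r3 r2 ->
  disjoint_reprs r3 (dadd_repr r1 r2).
Proof.
move=> d1 d2 M cM.
have {}cM g : g \in G -> r3 g *m lsubmx M = lsubmx M *m r1 g /\
                         r3 g *m rsubmx M = rsubmx M *m r2 g.
  move/cM; rewrite -{1 2}[M]hsubmxK dadd_reprE mul_mx_row mul_row_block.
  by rewrite !mulmx0 addr0 add0r => /eq_row_mx.
have u0 : lsubmx M = 0 by apply: d1 => g /cM[].
have v0 : rsubmx M = 0 by apply: d2 => g /cM[].
by rewrite -[M]hsubmxK u0 v0 row_mx0.
Qed.

(** The off-diagonal blocks of a commuting matrix are intertwiners between the summands. *)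
Lemma centgmx_dadd n1 n2 (r1 : mx_representation algC G n1)
    (r2 : mx_representation algC G n2) (M : 'M_(n1 + n2)) :
  disjoint_reprs r1 r2 -> disjoint_reprs r2 r1 ->
  centgmx (dadd_repr r1 r2) M ->
  exists M1 M2, [/\ centgmx r1 M1, centgmx r2 M2 & M = block_mx M1 0 0 M2].
Proof.
move=> d12 d21 /centgmxP cM.
have {}cM g : g \in G -> [/\ ulsubmx M *m r1 g = r1 g *m ulsubmx M,
    ursubmx M *m r2 g = r1 g *m ursubmx M,
    dlsubmx M *m r1 g = r2 g *m dlsubmx M
  & drsubmx M *m r2 g = r2 g *m drsubmx M].
  move/cM; rewrite -{1 2}[M]submxK dadd_reprE !mulmx_block.
  rewrite !(mulmx0, mul0mx, addr0, add0r).
  by case/eq_block_mx.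
exists (ulsubmx M), (drsubmx M); split.
- by apply/centgmxP => g /cM[].
- by apply/centgmxP => g /cM[].
have u0 : ursubmx M = 0 by apply: d12 => g /cM[].
have v0 : dlsubmx M = 0 by apply: d21 => g /cM[].
by rewrite -{1}[M]submxK u0 v0.
Qed.

Definition diag3_mx n0 n1 n2 (c0 c1 c2 : algC) : 'M_(n0 + n1 + n2) :=
  block_mx (block_mx c0%:M 0 0 c1%:M) 0 0 c2%:M.

Lemma mxtrace_diag3 n0 n1 n2 c0 c1 c2 :
  \tr (diag3_mx n0 n1 n2 c0 c1 c2) = c0 *+ n0 + c1 *+ n1 + c2 *+ n2.
Proof. by rewrite !mxtrace_block !mxtrace_scalar. Qed.

Lemma mul_diag3_mx n0 n1 n2 c0 c1 c2 d0 d1 d2 :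
  diag3_mx n0 n1 n2 c0 c1 c2 *m diag3_mx n0 n1 n2 d0 d1 d2
    = diag3_mx n0 n1 n2 (c0 * d0) (c1 * d1) (c2 * d2).
Proof.
by rewrite !mulmx_block !(mulmx0, mul0mx, addr0, add0r) -!scalar_mxM.
Qed.

Lemma irr_repr_irr (i : Iirr G) : mx_irreducible 'Chi_i.
Proof. exact: socle_irr. Qed.

Lemma centgmx_irr_repr (i : Iirr G) A : centgmx 'Chi_i A -> exists c, A = c%:M.
Proof.
move=> cA; apply/is_scalar_mxP; apply: mx_abs_irr_cent_scalar cA.
by apply: groupC (irr_repr_irr i).
Qed.

(** Equal characters give similar representations, and on the direct sum of the irreducibles Schur's
    lemma applies blockwise. The last clause serves to place the all-one vector in the component of
    [h], so that [c0] is its eigenvalue. *)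
Lemma centralizer_three_irr n (rG : mx_representation algC G n) (h i j : Iirr G) :
  'chi_h 1%g != 'chi_i 1%g -> 'chi_h 1%g != 'chi_j 1%g ->
  'chi_i 1%g != 'chi_j 1%g -> cfRepr rG = 'chi_h + 'chi_i + 'chi_j ->
  let d (l : Iirr G) := irr_degree (socle_of_Iirr l) in
  exists (P : 'M_(n, d h + d i + d j)) (Q : 'M_(d h + d i + d j, n)),
  [/\ P *m Q = 1%:M, Q *m P = 1%:M,
      forall A, centgmx rG A ->
        exists c0 c1 c2, A = P *m diag3_mx _ _ _ c0 c1 c2 *m Q
    & forall m (rH : mx_representation algC G m) (M : 'M_(m, n)),
        disjoint_reprs rH 'Chi_i -> disjoint_reprs rH 'Chi_j ->
        {in G, forall g, rH g *m M = M *m rG g} ->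
        exists M0, M = row_mx (row_mx M0 0) 0 *m Q].
Proof.
rewrite !irr1_degree !eqr_nat => nhi nhj nij chiE d.
pose r3 := dadd_repr (dadd_repr 'Chi_h 'Chi_i) 'Chi_j.
have : cfRepr rG = cfRepr r3 by rewrite !cfRepr_dadd_repr !irrRepr.
have disj (l m : Iirr G) : d l != d m -> disjoint_reprs 'Chi_l 'Chi_m.
  by apply: disjoint_irr; apply: irr_repr_irr.
move/cfRepr_inj => [P En freeP rGP].
have dhi := disj _ _ nhi; have dhj := disj _ _ nhj; have dij := disj _ _ nij.
rewrite eq_sym in nhi; rewrite eq_sym in nhj; rewrite eq_sym in nij.
have dih := disj _ _ nhi; have djh := disj _ _ nhj; have dji := disj _ _ nij.
have /row_freeP[Q PQ] := freeP.
have QP : Q *m P = 1%:M.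
  (* The type of [P] is rectangular; a one-sided inverse becomes two-sided once [En] identifies the
     dimensions. *)
  by move: (P) (Q) PQ; rewrite En => P1 Q1; apply: mulmx1C.
exists P, Q; split=> // [A /centgmxP cA | m rH M di dj cM].
  have : centgmx r3 (Q *m A *m P).
    apply/centgmxP => g Gg.
    have -> : Q *m A *m P *m r3 g = Q *m (A *m rG g) *m P.
      by rewrite -mulmxA -rGP // !mulmxA.
    have -> : r3 g *m (Q *m A *m P) = r3 g *m Q *m A *m P by rewrite !mulmxA.
    rewrite cA // mulmxA; congr (_ *m _ *m _).
    rewrite -[r3 g]mul1mx -QP -(mulmxA Q) -rGP // mulmxA.
    by rewrite -(mulmxA (Q *m rG g)) PQ mulmx1.
  case/centgmx_dadd => [||M1 [M2 [/centgmx_dadd cM1 cM2 EQ]]].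
  - exact: disjoint_daddl.
  - exact: disjoint_daddr.
  case: cM1 => // M3 [M4 [/centgmx_irr_repr[c0 E0] /centgmx_irr_repr[c1 E1] E]].
  have [c2 E2] := centgmx_irr_repr cM2.
  exists c0, c1, c2; rewrite /diag3_mx -E0 -E1 -E2 -E -EQ.
  by rewrite !mulmxA PQ mul1mx -mulmxA PQ mulmx1.
have cMP : {in G, forall g, rH g *m (M *m P) = (M *m P) *m r3 g}.
  by move=> g Gg; rewrite mulmxA cM // -!mulmxA rGP.
exists (lsubmx (lsubmx (M *m P))).
rewrite -[LHS]mulmx1 -PQ mulmxA; congr (_ *m _).
have {}cMP g : g \in G ->
    [/\ rH g *m lsubmx (lsubmx (M *m P)) = lsubmx (lsubmx (M *m P)) *m 'Chi_h g,
        rH g *m rsubmx (lsubmx (M *m P)) = rsubmx (lsubmx (M *m P)) *m 'Chi_i g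
      & rH g *m rsubmx (M *m P) = rsubmx (M *m P) *m 'Chi_j g].
  move/cMP; rewrite -{1 2}[M *m P]hsubmxK -[lsubmx (M *m P)]hsubmxK.
  rewrite !dadd_reprE !mul_mx_row !mul_row_block !(mulmx0, mul0mx, addr0, add0r).
  by rewrite !row_mxKl !row_mxKr => /eq_row_mx[/eq_row_mx[]].
rewrite -{1}[M *m P]hsubmxK -{1}[lsubmx (M *m P)]hsubmxK.
have u0 : rsubmx (lsubmx (M *m P)) = 0 by apply: di => g /cMP[].
have v0 : rsubmx (M *m P) = 0 by apply: dj => g /cMP[].
by rewrite u0 v0.
Qed.

End Intertwiners.

(** * Recovering two eigenvalues from their power sums *)

Section Moments.

Variables a b : nat.
Hypotheses (a_gt0 : (0 < a)%N) (b_gt0 : (0 < b)%N) (neq_ab : a != b).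

(* Solves the moment equations for x: with n = a + b and mean t1 / n, the second
   and third central moments are a b n w^2 and a b n (b - a) w^3, where
   w = (x - y) / n, and x - t1 / n = b w.  When w = 0 the formula still holds,
   because 0 / 0 = 0. *)
Definition moment_sol (t1 t2 t3 : algC) : algC :=
  let n := a%:R + b%:R in
  t1 / n + b%:R * ((t3 - 3 * t1 / n * t2 + 2 * t1 ^+ 3 / n ^+ 2)
                   / ((t2 - t1 ^+ 2 / n) * (b%:R - a%:R))).

Lemma moment_solE (x y : algC) :
  x = moment_sol (x *+ a + y *+ b) (x ^+ 2 *+ a + y ^+ 2 *+ b)
                 (x ^+ 3 *+ a + y ^+ 3 *+ b).
Proof.
have n0 : a%:R + b%:R != 0 :> algC by rewrite -natrD pnatr_eq0; lia.
have d0 : b%:R - a%:R != 0 :> algC by rewrite subr_eq0 eqr_nat eq_sym.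
have ha : a%:R != 0 :> algC by rewrite pnatr_eq0; lia.
have hb : b%:R != 0 :> algC by rewrite pnatr_eq0; lia.
rewrite /moment_sol -!(mulr_natr x) -!(mulr_natr y).
rewrite -!(mulr_natr (x ^+ _)) -!(mulr_natr (y ^+ _)).
move: n0 d0 ha hb; move: (a%:R : algC) (b%:R : algC) => u v n0 d0 ha hb.
pose w := (x - y) / (u + v).
have Ew : x - y = w * (u + v) by rewrite /w mulfVK.
have Ex : x = y + w * (u + v) by rewrite -Ew addrC subrK.
have E2 : x ^+ 2 * u + y ^+ 2 * v - (x * u + y * v) ^+ 2 / (u + v)
          = u * v * (u + v) * w ^+ 2 by rewrite Ex; field.
have E3 : x ^+ 3 * u + y ^+ 3 * v
    - 3 * (x * u + y * v) / (u + v) * (x ^+ 2 * u + y ^+ 2 * v)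
    + 2 * (x * u + y * v) ^+ 3 / (u + v) ^+ 2
  = u * v * (u + v) * (v - u) * w ^+ 3 by rewrite Ex; field.
rewrite E2 E3.
have [w0 | nw] := eqVneq w 0.
  rewrite w0 !expr0n !mulr0 !mul0r mulr0 addr0.
  by rewrite Ex w0; field.
rewrite Ex; field.
by rewrite n0 d0 nw ha hb.
Qed.

Lemma moment_sol_rat t1 t2 t3 :
  t1 \in Crat -> t2 \in Crat -> t3 \in Crat -> moment_sol t1 t2 t3 \in Crat.
Proof.
move=> q1 q2 q3; rewrite /moment_sol.
by rewrite !(rpredD, rpredN, rpredM, rpredV, rpredX, rpred_nat).
Qed.

End Moments.

(** * Integrality and existence of eigenvalues *)

Lemma eigenvalue_int_Aint n (B : 'M[int]_n) (c : algC) :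
  eigenvalue (map_mx intr B) c -> c \in Aint.
Proof.
rewrite eigenvalue_root_char -map_char_poly => rc.
apply: root_monic_Aint rc _ _; first by rewrite map_char_poly char_poly_monic.
by apply/polyOverP => i; rewrite coef_map; apply: intr_int.
Qed.

(** An eigenvector is the all-one vector of the relevant block multiplied by [Q]; it is nonzero
    because the block is nonempty and [Q] is invertible. *)
Lemma eigenvalue_diag3 n n0 n1 n2 (P : 'M_(n, n0 + n1 + n2))
    (Q : 'M_(n0 + n1 + n2, n)) (c0 c1 c2 : algC) :
  Q *m P = 1%:M -> (0 < n1)%N -> (0 < n2)%N ->
  eigenvalue (P *m diag3_mx _ _ _ c0 c1 c2 *m Q) c1 /\
  eigenvalue (P *m diag3_mx _ _ _ c0 c1 c2 *m Q) c2.
Proof.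
move=> QP n1_gt0 n2_gt0.
have nz1 m : (0 < m)%N -> const_mx 1 != 0 :> 'rV[algC]_m.
  case: m => // m _; apply/eqP => /matrixP/(_ 0 0)/eqP.
  by rewrite !mxE oner_eq0.
have nzQ (v : 'rV_(n0 + n1 + n2)) : v != 0 -> v *m Q != 0.
  apply: contraNneq => vQ0.
  by rewrite -[v]mulmx1 -QP mulmxA vQ0 mul0mx.
split; apply/eigenvalueP.
  exists (row_mx (row_mx 0 (const_mx 1)) 0 *m Q); last first.
    by apply: nzQ; rewrite !row_mx_eq0 !eqxx andbT nz1.
  rewrite !mulmxA -[_ *m Q *m P]mulmxA QP mulmx1 scalemxAl; congr (_ *m _).
  rewrite !mul_row_block !(mulmx0, mul0mx, addr0, add0r) mul_mx_scalar.
  by rewrite !scale_row_mx !scaler0.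
exists (row_mx 0 (const_mx 1) *m Q); last first.
  by apply: nzQ; rewrite row_mx_eq0 eqxx nz1.
rewrite !mulmxA -[_ *m Q *m P]mulmxA QP mulmx1 scalemxAl; congr (_ *m _).
rewrite !mul_row_block !(mulmx0, mul0mx, addr0, add0r) mul_mx_scalar.
by rewrite scale_row_mx scaler0.
Qed.

(** * The permutation representation and its invariant matrices *)

Section PermRepr.

Variables (T : finType).

Definition fun_mx (R : nmodType) (f : T -> T -> R) : 'M[R]_#|T| :=
  \matrix_(i, j) f (enum_val i) (enum_val j).

Lemma sum_enum_val (R : nmodType) (f : T -> R) :
  \sum_(i < #|T|) f (enum_val i) = \sum_x f x.
Proof. by rewrite -(big_enum_val f). Qed.

Lemma mul_fun_mx (f g : T -> T -> algC) :
  fun_mx f *m fun_mx g = fun_mx (fun x y => \sum_z f x z * g z y).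
Proof.
apply/matrixP => i j; rewrite !mxE -sum_enum_val.
by apply: eq_bigr => k _; rewrite !mxE.
Qed.

Lemma mxtrace_fun_mx (R : pzSemiRingType) (f : T -> T -> R) :
  \tr (fun_mx f) = \sum_x f x x.
Proof. by rewrite -sum_enum_val; apply: eq_bigr => i _; rewrite mxE. Qed.

Lemma eq_fun_mx (R : nmodType) (f g : T -> T -> R) :
  (forall x y, f x y = g x y) -> fun_mx f = fun_mx g.
Proof. by move=> fg; apply/matrixP => i j; rewrite !mxE fg. Qed.

Variable G : {group {perm T}}.

Definition perm_fun_mx (g : {perm T}) : 'M[algC]_#|T| :=
  fun_mx (fun x y => (g x == y)%:R).

Lemma perm_fun_mx_repr : mx_repr G perm_fun_mx.
Proof.
split=> [|g h _ _].
  by apply/matrixP => i j; rewrite !mxE perm1 (inj_eq enum_val_inj).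
rewrite mul_fun_mx; apply: eq_fun_mx => x y.
rewrite (bigD1 (g x)) //= eqxx mul1r permM big1 ?addr0 // => z nz.
by rewrite eq_sym (negbTE nz) mul0r.
Qed.

Definition perm_repr := MxRepresentation perm_fun_mx_repr.

(** The trace of a permutation matrix counts its fixed points. *)
Lemma cfRepr_perm : cfRepr perm_repr = perm_char G.
Proof.
apply/cfun_inP => g Gg; rewrite !cfunE Gg /= mxtrace_fun_mx.
rewrite -sum1_card natr_sum !mulr1n [RHS]big_mkcond /=.
apply: eq_bigr => x _; case: eqP => [gx | ngx].
  by rewrite (introT afix1P).
by case: ifP => // /afix1P.
Qed.

Lemma centgmx_perm (f : T -> T -> algC) :
  (forall g x y, g \in G -> f (g x) (g y) = f x y) ->
  centgmx perm_repr (fun_mx f).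
Proof.
move=> fG; apply/centgmxP => g Gg; rewrite !mul_fun_mx.
apply: eq_fun_mx => x y.
rewrite (bigD1 (g^-1%g y)) //= permKV eqxx mulr1 big1 ?addr0; last first.
  move=> z; rewrite -(inj_eq (@perm_inj _ g)) permKV => /negbTE->.
  by rewrite mulr0.
rewrite (bigD1 (g x)) //= eqxx mul1r big1 ?addr0; last first.
  by move=> z; rewrite eq_sym => /negbTE->; rewrite mul0r.
by rewrite -(fG _ x _ Gg) permKV.
Qed.

Lemma ones_perm_repr g : const_mx 1 *m perm_repr g = const_mx 1 :> 'rV_#|T|.
Proof.
apply/rowP => j; rewrite !mxE.
under eq_bigr do rewrite !mxE mul1r.
rewrite (sum_enum_val (fun x => (g x == enum_val j)%:R)).
rewrite (bigD1 (g^-1%g (enum_val j))) //= permKV eqxx big1 ?addr0 // => z.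
by rewrite -(inj_eq (@perm_inj _ g)) permKV => /negbTE->.
Qed.

Lemma ones_fun_mx (f : T -> T -> algC) j :
  (const_mx 1 *m fun_mx f : 'rV_#|T|) 0 j = \sum_x f x (enum_val j).
Proof.
rewrite !mxE; under eq_bigr do rewrite !mxE mul1r.
exact: (sum_enum_val (fun x => f x (enum_val j))).
Qed.

End PermRepr.

(** * Eigenvalues of orbital matrices in Type III *)

Section TypeIII.

Variables (T : finType) (G : {group {perm T}}) (p : nat).
Hypotheses (p_gt3 : (3 < p)%N) (degG : #|T| = (3 * p)%N) (typeG : type_III G p).

Lemma triv_mx_repr : mx_repr G (fun _ : {perm T} => 1%:M : 'M[algC]_1).
Proof. by split=> // g h _ _; rewrite mulmx1. Qed.

Lemma triv_mx_irr : mx_irreducible (MxRepresentation triv_mx_repr).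
Proof.
apply/mx_irrP; split=> // U _; rewrite -mxrank_eq0 -lt0n /row_full => U_gt0.
by rewrite eqn_leq rank_leq_col.
Qed.

Lemma type_III_centralizer :
  exists (P : 'M[algC]_(#|T|, 1 + 2 * p + (p - 1))) Q,
  [/\ P *m Q = 1%:M, Q *m P = 1%:M & forall A, centgmx (perm_repr G) A ->
      exists c0 c1 c2, A = P *m diag3_mx _ _ _ c0 c1 c2 *m Q /\
        const_mx 1 *m A = c0 *: (const_mx 1 : 'rV_#|T|)].
Proof.
have [i [j [_ di dj chiE]]] := typeG.
pose d (l : Iirr G) := irr_degree (socle_of_Iirr l).
have d0 : d 0 = 1%N.
  by apply/eqP; rewrite -(eqr_nat algC) -irr1_degree irr0 cfun11.
have Ei : d i = (2 * p)%N by apply/eqP; rewrite -(eqr_nat algC) -irr1_degree di.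
have Ej : d j = (p - 1)%N by apply/eqP; rewrite -(eqr_nat algC) -irr1_degree dj.
have [] := @centralizer_three_irr _ G _ (perm_repr G) 0 i j.
- by rewrite !irr1_degree eqr_nat -/(d 0) -/(d i) d0 Ei; lia.
- by rewrite !irr1_degree eqr_nat -/(d 0) -/(d j) d0 Ej; lia.
- by rewrite !irr1_degree eqr_nat -/(d i) -/(d j) Ei Ej; lia.
- by rewrite cfRepr_perm chiE irr0.
rewrite -/d => P [Q [PQ QP cP fixP]].
have irr_triv := triv_mx_irr.
(* The all-one row intertwines the trivial representation, of degree 1, with the permutation
   representation. *)
case: (fixP _ (MxRepresentation triv_mx_repr) (const_mx 1)).
- by apply: disjoint_irr => //; [apply: irr_repr_irr | rewrite -/(d i) Ei; lia].
- by apply: disjoint_irr => //; [apply: irr_repr_irr | rewrite -/(d j) Ej; lia].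
- by move=> g _; rewrite ones_perm_repr mul1mx.
move=> M0 onesE.
(* The block sizes occur in the types of [P] and [Q], so they are replaced by their values in the
   whole existential statement at once. *)
have {fixP irr_triv} : exists (P : 'M[algC]_(#|T|, d 0 + d i + d j)) Q,
  [/\ P *m Q = 1%:M, Q *m P = 1%:M & forall A, centgmx (perm_repr G) A ->
      exists c0 c1 c2, A = P *m diag3_mx _ _ _ c0 c1 c2 *m Q /\
        const_mx 1 *m A = c0 *: (const_mx 1 : 'rV_#|T|)].
  exists P, Q; split=> // A /cP[c0 [c1 [c2 ->]]].
  exists c0, c1, c2; split=> //.
  rewrite onesE !mulmxA -(mulmxA _ Q) QP mulmx1 scalemxAl; congr (_ *m _).
  rewrite !mul_row_block !(mulmx0, mul0mx, addr0, add0r) mul_mx_scalar.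
  by rewrite !scale_row_mx !scaler0.
by rewrite d0 Ei Ej.
Qed.

Section Orbital.

Variables (r : rel T) (k : nat).
Hypotheses (rG : forall g x y, g \in G -> r (g x) (g y) = r x y)
  (r_irr : irreflexive r) (r_deg : forall x, #|r x| = k).

(** Here [u] and [v] are the eigenvalues on the constituents of degrees 2p and p - 1; the equations
    are tr A = 0 and tr (A A^T) = 3pk. *)
Lemma type_III_eigenvalues : exists u v : int,
  k%:Z + 2 * p%:Z * u + (p%:Z - 1) * v = 0 /\
  k%:Z ^+ 2 + 2 * p%:Z * u ^+ 2 + (p%:Z - 1) * v ^+ 2 = 3 * p%:Z * k%:Z.
Proof.
have [P [Q [PQ QP cP]]] := type_III_centralizer.
pose f x y : algC := (r x y)%:R.
pose A := fun_mx f; pose B : 'M[int]_#|T| := fun_mx (fun x y => (r x y)%:R).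
have BA : map_mx intr B = A.
  by apply/matrixP => i j; rewrite !mxE natz -pmulrn.
have tr3 c0 c1 c2 : \tr (P *m diag3_mx 1 (2 * p) (p - 1) c0 c1 c2 *m Q)
    = c0 + c1 *+ (2 * p) + c2 *+ (p - 1).
  by rewrite mxtrace_mulC mulmxA QP mul1mx mxtrace_diag3.
have mul3 c0 c1 c2 d0 d1 d2 :
  (P *m diag3_mx 1 (2 * p) (p - 1) c0 c1 c2 *m Q)
    *m (P *m diag3_mx 1 (2 * p) (p - 1) d0 d1 d2 *m Q)
  = P *m diag3_mx 1 (2 * p) (p - 1) (c0 * d0) (c1 * d1) (c2 * d2) *m Q.
  by rewrite -mul_diag3_mx !mulmxA -(mulmxA _ Q) QP mulmx1.
have cA : centgmx (perm_repr G) A.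
  by apply: centgmx_perm => g x y Gg; rewrite /f rG.
have ATE : A^T = fun_mx (fun x y => f y x).
  by apply/matrixP => i j; rewrite !mxE.
have cAT : centgmx (perm_repr G) A^T.
  by rewrite ATE; apply: centgmx_perm => g x y Gg; rewrite /f rG.
have [c0 [c1 [c2 [EA oA]]]] := cP _ cA.
have [d0 [d1 [d2 [EAT oAT]]]] := cP _ cAT.
have sum_r x : \sum_y f x y = k%:R.
  rewrite -natr_sum -(r_deg x) -sum1_card; congr _%:R.
  rewrite [RHS]big_mkcond /=; apply: eq_bigr => y _.
  by rewrite unfold_in; case: (r x y).
have T_gt0 : (0 < #|T|)%N by rewrite degG; lia.
have j0 : 'I_#|T| by exists 0%N.
(* The entries of the all-one row times A^T are the row sums of A, all equal to k. *)
have d0E : d0 = k%:R.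
  move/rowP/(_ j0): oAT; rewrite !mxE mulr1 => <-.
  under eq_bigr do rewrite !mxE mul1r.
  by rewrite (sum_enum_val (fun y => f (enum_val j0) y)) sum_r.
(* [r_deg] gives row sums, whereas [c0] is a column sum; adding up all entries of A gives
   [c0 * #|T| = k * #|T|]. *)
have c0E : c0 = k%:R.
  have n0 : (#|T|%:R : algC) != 0 by rewrite pnatr_eq0 -lt0n.
  apply: (mulIf n0).
  have /(congr1 (fun M : 'rV_#|T| => \sum_j M 0 j)) := oA.
  have -> : \sum_j (c0 *: const_mx 1 : 'rV_#|T|) 0 j = c0 * #|T|%:R.
    under eq_bigr do rewrite !mxE mulr1.
    by rewrite sumr_const card_ord mulr_natr.
  move=> <-.
  under eq_bigr do rewrite (ones_fun_mx f).
  rewrite (sum_enum_val (fun y => \sum_x f x y)) exchange_big /=.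
  under eq_bigr do rewrite sum_r.
  by rewrite sumr_const mulr_natr.
have t1 : k%:R + (c1 *+ (2 * p) + c2 *+ (p - 1)) = 0.
  rewrite addrA -c0E -tr3 -EA mxtrace_fun_mx big1 // => x _.
  by rewrite /f r_irr.
have t1' : k%:R + (d1 *+ (2 * p) + d2 *+ (p - 1)) = 0.
  rewrite addrA -{1}d0E -tr3 -EAT mxtrace_tr mxtrace_fun_mx big1 // => x _.
  by rewrite /f r_irr.
have trN M : \tr (map_mx intr M : 'M[algC]_#|T|) \in Crat.
  by rewrite rpred_sum // => x _; rewrite mxE rpred_int.
have t2 : k%:R ^+ 2 + (c1 ^+ 2 *+ (2 * p) + c2 ^+ 2 *+ (p - 1)) = \tr (A *m A).
  by rewrite EA mul3 tr3 c0E -!expr2 addrA.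
have t2' : k%:R ^+ 2 + (d1 ^+ 2 *+ (2 * p) + d2 ^+ 2 *+ (p - 1)) = \tr (A *m A).
  by rewrite -[RHS]mxtrace_tr trmx_mul EAT mul3 tr3 d0E -!expr2 addrA.
have t3 : k%:R ^+ 3 + (c1 ^+ 3 *+ (2 * p) + c2 ^+ 3 *+ (p - 1))
    = \tr (A *m (A *m A)).
  by rewrite EA !mul3 tr3 c0E -!expr2 -!exprS addrA.
have t3' : k%:R ^+ 3 + (d1 ^+ 3 *+ (2 * p) + d2 ^+ 3 *+ (p - 1))
    = \tr (A *m (A *m A)).
  rewrite -[RHS]mxtrace_tr !trmx_mul -mulmxA EAT !mul3 tr3 d0E.
  by rewrite -!expr2 -!exprS addrA.
have t2Q : \tr (A *m A) \in Crat by rewrite -BA -map_mxM.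
have t3Q : \tr (A *m (A *m A)) \in Crat by rewrite -BA -!map_mxM.
have tE (a b c : algC) : a + b = c -> b = c - a.
  by move=> <-; rewrite addrC addKr.
have [n1 n2 n12] : [/\ 0 < 2 * p, 0 < p - 1 & 2 * p != p - 1]%N by split; lia.
have n21 : (p - 1 != 2 * p)%N by rewrite eq_sym.
have kQ : k%:R \in Crat by apply: rpred_nat.
(* A and A^T agree in the traces of their first three powers and in the eigenvalue k, so
   [moment_sol] has the same arguments for both. *)
have dc1 : d1 = c1.
  rewrite (moment_solE n1 n2 n12 c1 c2) (moment_solE n1 n2 n12 d1 d2).
  by rewrite (tE _ _ _ t1) (tE _ _ _ t2) (tE _ _ _ t3)
             (tE _ _ _ t1') (tE _ _ _ t2') (tE _ _ _ t3').
have dc2 : d2 = c2.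
  rewrite (moment_solE n2 n1 n21 c2 c1) (moment_solE n2 n1 n21 d2 d1).
  rewrite ![_ *+ (p - 1) + _]addrC.
  by rewrite (tE _ _ _ t1) (tE _ _ _ t2) (tE _ _ _ t3)
             (tE _ _ _ t1') (tE _ _ _ t2') (tE _ _ _ t3').
have [e1 e2] : eigenvalue (map_mx intr B) c1 /\ eigenvalue (map_mx intr B) c2.
  by rewrite BA EA; apply: eigenvalue_diag3.
(* It is rational by the moment formula and an algebraic integer as an eigenvalue of the integer
   matrix [B]. *)
have c1Z : c1 \in Num.int.
  apply: Cint_rat_Aint (eigenvalue_int_Aint e1).
  rewrite (moment_solE n1 n2 n12 c1 c2).
  rewrite (tE _ _ _ t1) (tE _ _ _ t2) (tE _ _ _ t3).
  by apply: moment_sol_rat; rewrite rpredB ?rpredX ?rpred0.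
have c2Z : c2 \in Num.int.
  apply: Cint_rat_Aint (eigenvalue_int_Aint e2).
  rewrite (moment_solE n2 n1 n21 c2 c1).
  rewrite ![_ *+ (p - 1) + _]addrC.
  rewrite (tE _ _ _ t1) (tE _ _ _ t2) (tE _ _ _ t3).
  by apply: moment_sol_rat; rewrite rpredB ?rpredX ?rpred0.
have tAA : \tr (A *m A^T) = (3 * p * k)%:R.
  rewrite ATE mul_fun_mx mxtrace_fun_mx -degG natrM mulr_natl.
  rewrite -sumr_const; apply: eq_bigr => x _; rewrite -(sum_r x).
  by apply: eq_bigr => y _; rewrite /f; case: (r x y); rewrite ?mulr1 ?mulr0.
(* As A^T has the same eigenvalues blockwise, tr (A A^T) becomes a sum of squares. *)
rewrite EAT EA mul3 tr3 dc1 dc2 c0E d0E -!expr2 in tAA.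
move: t1 tAA => /=.
have [u ->] := intrP c1Z; have [v ->] := intrP c2Z => t1 tAA.
have p1 : (p - 1)%:R = p%:R - 1 :> algC by rewrite natrB //; lia.
exists u, v; split; apply: (@intr_inj algC).
  rewrite !(rmorphD, rmorphB, rmorphM) /= -!pmulrn.
  move: t1; rewrite -!(mulr_natr (_%:~R)) p1 natrM => t1.
  by rewrite -[RHS]t1; ring.
rewrite !(rmorphD, rmorphB, rmorphM, rmorphXn) /= -!pmulrn.
move: tAA; rewrite -!(mulr_natr (_ ^+ 2)) p1 !natrM => tAA.
by rewrite -[RHS]tAA; ring.
Qed.

End Orbital.

End TypeIII.

(** * Solving the two trace equations in integers *)

Lemma type_III_arith (p k : nat) (u v : int) :
  (2 <= p)%N -> (0 < k)%N -> (2 * k < 3 * p)%N -> k != 2 ->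
  k%:Z + 2 * p%:Z * u + (p%:Z - 1) * v = 0 ->
  k%:Z ^+ 2 + 2 * p%:Z * u ^+ 2 + (p%:Z - 1) * v ^+ 2 = 3 * p%:Z * k%:Z ->
  p%:Z = 3 * u ^+ 2 + 3 * u + 1 /\
  (k%:Z = p%:Z - 2 * u - 1 \/ k%:Z = 2 * p%:Z - 2 * u - 2).
Proof.
move=> p2 k0 kp k2 e1 e2; pose m : int := - (2 * u + v).
have kE : k%:Z = m * (p%:Z - 1) - 2 * u by rewrite /m; lia.
have vE : v = - m - 2 * u by rewrite /m; lia.
have p0 : p%:Z != 0 by lia.
clearbody m.
have mE : m * (3 - m) * (p%:Z - 1) = 6 * (u * (u + 1)).
  (* After substituting for k and v, the quadratic equation is p times the claimed one. *)
  by apply: (mulfI p0); move: e2; rewrite kE vE => e2; lia.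
(* No integer lies strictly between -1 and 0. *)
have u_ge0 : 0 <= u * (u + 1).
  by have [u0 | u0] := lerP 0 u; [apply: mulr_ge0 | apply: mulr_le0]; lia.
have m_ge0' : 0 <= m * (3 - m).
  have p1 : 0 < p%:Z - 1 by lia.
  by rewrite -(pmulr_lge0 _ p1) mE mulr_ge0.
have m_ge0 : 0 <= m.
  rewrite leNgt; apply/negP => m0; move: m_ge0'; rewrite nmulr_rge0 // => ?.
  lia.
have m_le3 : m <= 3.
  rewrite leNgt; apply/negP => m3; move: m_ge0'; rewrite pmulr_rge0 => [?|].
    lia.
  lia.
have {m_ge0 m_le3} : [\/ m = 0, m = 1, m = 2 | m = 3].
  have [m0|] := eqVneq m 0; first by constructor 1.
  have [m1|] := eqVneq m 1; first by constructor 2.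
  have [m2|] := eqVneq m 2; first by constructor 3.
  by move=> *; constructor 4; lia.
case=> m_eq; rewrite m_eq in mE kE.
(* For m = 0, k = -2u is 0 or 2, both excluded. *)
- have /eqP : u * (u + 1) = 0 by lia.
  rewrite mulf_eq0 => /orP u01.
  have : u = 0 \/ u = -1 by case: u01 => /eqP; lia.
  by case=> uE; rewrite uE in kE; lia.
- by split; [lia | left; lia].
- by split; [lia | right; lia].
(* For m = 3, k is 3p - 3 or 3p - 1, too large for 2k < 3p. *)
- have /eqP : u * (u + 1) = 0 by lia.
  rewrite mulf_eq0 => /orP u01.
  have : u = 0 \/ u = -1 by case: u01 => /eqP; lia.
  by case=> uE; rewrite uE in kE; lia.
Qed.

(** * Suborbits of a transitive group and their number *)

Section Suborbits.

Variables (T : finType) (G : {group {perm T}}).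

Definition suborbits (x : T) : {set {set T}} :=
  orbit 'P 'C_G[x | 'P]%g @: [set: T].

(** The stabiliser of [g x] is the conjugate by [g] of the stabiliser of [x]. *)
Lemma orbit_astab_conj (g : {perm T}) x y : g \in G ->
  orbit 'P 'C_G[g x | 'P]%g (g y) = g @: orbit 'P 'C_G[x | 'P]%g y.
Proof.
move=> Gg; have -> : 'C_G[g x | 'P]%g = ('C_G[x | 'P] :^ g)%g.
  by rewrite conjIg conjGid // -astab1_act.
apply/setP => z; rewrite -[z](permKV g) mem_imset; last exact: perm_inj.
exact: (orbit_conjsg 'P).
Qed.

Lemma suborbits_conj (g : {perm T}) x : g \in G ->
  suborbits (g x) = (fun B : {set T} => g @: B) @: suborbits x.
Proof.
move=> Gg; apply/setP => B.
apply/imsetP/imsetP => [[y _ ->]|[_ /imsetP[y _ ->] ->]].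
  exists (orbit 'P 'C_G[x | 'P]%g (g^-1%g y)); first by rewrite imset_f.
  by rewrite -orbit_astab_conj // permKV.
by exists (g y); rewrite ?orbit_astab_conj.
Qed.

Hypothesis trG : [transitive G, on [set: T] | 'P].

Lemma transitive_perm x y : exists2 g, g \in G & y = g x.
Proof. exact: (atransP2 trG). Qed.

Lemma card_astab_transitive x : (#|T| * #|'C_G[x | 'P]%g|)%N = #|G|.
Proof.
by rewrite -[RHS](card_orbit_stab 'P G x) (atransP trG) ?inE // cardsT.
Qed.

Lemma perm_suborbit_sizes x y :
  perm_eq (suborbit_sizes G x) (suborbit_sizes G y).
Proof.
have [g Gg ->] := transitive_perm x y; rewrite /suborbit_sizes /image_mem.
rewrite -/(suborbits _) -/(suborbits _) suborbits_conj //.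
have injg : injective (fun B : {set T} => g @: B).
  exact: imset_inj (@perm_inj _ g).
rewrite perm_sym.
have /perm_trans -> // : perm_eq
    [seq #|B| | B : {set T} <- enum ((fun B : {set T} => g @: B) @: suborbits x)]
    [seq #|B| | B : {set T} <-
       map (fun B : {set T} => g @: B) (enum (suborbits x))].
  apply: perm_map; apply: uniq_perm; rewrite ?map_inj_uniq ?enum_uniq //.
  move=> B; rewrite mem_enum; apply/imsetP/mapP => -[C inC ->]; exists C => //.
    by rewrite mem_enum.
  by rewrite -mem_enum.
rewrite -map_comp (eq_map (g := fun B : {set T} => #|B|)) // => B /=.
exact: card_imset (@perm_inj _ g).
Qed.

Lemma card_suborbits x y : #|suborbits x| = #|suborbits y|.
Proof.
have [g Gg ->] := transitive_perm x y; rewrite suborbits_conj //.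
by apply/esym/card_imset; exact: imset_inj (@perm_inj _ g).
Qed.

Lemma perm_charE g : g \in G -> perm_char G g = #|'Fix_'P[g]%g|%:R.
Proof.
move=> Gg; rewrite cfunE -[RHS]/(_ *+ true); congr (_ *+ nat_of_bool _).
exact: Gg.
Qed.

(* Both sides times |G| count the triples (g, y, z) with g in G fixing y and z. *)
Lemma cfnorm_perm_char x : '[perm_char G] = #|suborbits x|%:R.
Proof.
have G0 : #|G|%:R != 0 :> algC by rewrite pnatr_eq0 -lt0n cardG_gt0.
apply: (mulfI G0); rewrite cfdotE mulVKf // -natrM.
transitivity ((\sum_(g in G) #|'Fix_'P[g]%g| * #|'Fix_'P[g]%g|)%N%:R : algC).
  rewrite natr_sum; apply: eq_bigr => g Gg.
  by rewrite perm_charE // conjC_nat natrM.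
congr _%:R.
transitivity (\sum_(y : T) \sum_(g in 'C_G[y | 'P]%g) #|'Fix_'P[g]%g|)%N.
  rewrite (exchange_big_dep [in G]) /=; last by move=> y g _ /setIP[].
  apply: eq_bigr => g Gg; rewrite -sum1_card big_distrl /=.
  apply: eq_big => [y | y _]; last by rewrite mul1n.
  by apply/afix1P/setIP => [/astab1P | [_ /astab1P]].
(* Orbit counting (Cauchy-Frobenius) within each point stabiliser. *)
transitivity (\sum_(y : T) #|suborbits y| * #|'C_G[y | 'P]%g|)%N.
  apply: eq_bigr => y _.
  have /Frobenius_Cauchy <- : [acts 'C_G[y | 'P]%g, on [set: T] | 'P].
    by apply/actsP => g _ z; rewrite !inE.
  by apply: eq_bigr => g _; rewrite setTI.
under eq_bigr => y _ do rewrite (card_suborbits y x).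
rewrite -big_distrr /= mulnC; congr (_ * _)%N.
have T0 : (0 < #|T|)%N by apply/card_gt0P; exists x.
rewrite (eq_bigr (fun _ => #|'C_G[x | 'P]%g|)) => [|y _].
  by rewrite sum_nat_const; apply: card_astab_transitive.
apply/eqP; rewrite -(eqn_pmul2l T0); apply/eqP.
exact: etrans (card_astab_transitive y) (esym (card_astab_transitive x)).
Qed.

(** One suborbit is the singleton of [x]; the other two are ordered by size, and [d] represents the
    smaller, whose orbital is studied. *)
Lemma suborbit_sizes_rank3 x : #|suborbits x| = 3 ->
  exists d e, let k := #|orbit 'P 'C_G[x | 'P]%g d| in
    let l := #|orbit 'P 'C_G[x | 'P]%g e| in
  [/\ d != x, (0 < k)%N, (k <= l)%N, (1 + k + l)%N = #|T|
    & perm_eq (suborbit_sizes G x) [:: 1; k; l]%N].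
Proof.
move=> card3; set H := 'C_G[x | 'P]%g.
have Hx : orbit 'P H x = [set x].
  by apply/orbit1P/afixP => g /setIP[_ /astab1P].
have inx : [set x] \in suborbits x by rewrite -Hx imset_f.
have /cards2P[B [C [nBC BCE]]] : #|suborbits x :\ [set x]| == 2.
  have := cardsD1 [set x] (suborbits x); rewrite inx card3 add1n => -[] /eqP.
  by rewrite eq_sym.
have subE : suborbits x = [set x] |: [set B; C] by rewrite -BCE setD1K.
wlog leBC : B C nBC BCE subE / (#|B| <= #|C|)%N.
  move=> IH; have [/IH | /ltnW/IH] := leqP #|B| #|C|; first exact.
  by apply; [rewrite eq_sym | rewrite setUC | rewrite (setUC [set C])].
have /setD1P[nB /imsetP[d _ BE]] : B \in suborbits x :\ [set x].
  by rewrite BCE !inE eqxx.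
have /setD1P[nC /imsetP[e _ CE]] : C \in suborbits x :\ [set x].
  by rewrite BCE !inE eqxx orbT.
have uBC : uniq [:: [set x]; B; C].
  by rewrite /= !inE !negb_or ![[set x] == _]eq_sym nB nC nBC.
have pE : perm_eq (enum (suborbits x)) [:: [set x]; B; C].
  apply: uniq_perm; rewrite ?enum_uniq // => D.
  by rewrite mem_enum subE !inE orbA.
exists d, e; rewrite -/H -BE -CE; split=> //.
- by apply: contraNneq nB => dx; rewrite BE dx Hx.
- by rewrite BE; apply/card_gt0P; exists d; apply: orbit_refl.
- have /acts_sum_card_orbit : [acts H, on [set: T] | 'P].
    by apply/actsP => g _ z; rewrite !inE.
  rewrite cardsT -/(suborbits x) => <-.
  rewrite -big_enum /= (perm_big _ pE) /= !big_cons big_nil cards1.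
  by rewrite addn0 addnA.
by rewrite -(cards1 x); apply: (perm_map (fun B : {set T} => #|B|) pE).
Qed.

End Suborbits.

(** The stabiliser [K] of both points turns out to be normal in G. A normal subgroup of a primitive
    group is trivial or transitive, and [K] fixes [x], so it is trivial, while its index in the
    stabiliser of [x] is 2. *)
Lemma primitive_suborbit2 (T : finType) (G : {group {perm T}}) x d :
  [primitive G, on [set: T] | 'P] -> #|orbit 'P 'C_G[x | 'P]%g d| = 2 ->
  #|'C_G[x | 'P]%g| = 2.
Proof.
move=> primG; have /andP[trG _] := primG.
set H := 'C_G[x | 'P]%G; set L := 'C_G[d | 'P]%G => orb2.
have max : maximal_eq H G by rewrite -(trans_prim_astab (S := setT)) ?inE.
have cHL : #|H| = #|L|.
  have T0 : (0 < #|T|)%N by apply/card_gt0P; exists x.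
  apply/eqP; rewrite -(eqn_pmul2l T0); apply/eqP.
  apply: etrans (card_astab_transitive trG x) _.
  exact: esym (card_astab_transitive trG d).
pose K := (H :&: L)%G.
have KE : 'C_H[d | 'P]%g = K.
  by rewrite /K /= setIA (setIidPl (subsetIl _ _)).
have indH : #|H : K| = 2 by rewrite -KE -card_orbit.
have cK : (#|K| * 2 = #|H|)%N.
  by rewrite -[RHS](Lagrange (subsetIl H L)) [in RHS]indH.
have indL : #|L : K| = 2.
  apply/eqP; rewrite -(eqn_pmul2l (cardG_gt0 K)) Lagrange ?subsetIr //.
  by rewrite -cHL cK.
have nKH := index2_normal (subsetIl _ _) indH.
have nKL := index2_normal (subsetIr _ _) indL.
have [sHG maxH] := maximal_eqP _ _ max.
(* K has index 2 in the distinct stabilisers H and L, which generate G because H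
   is maximal. *)
have nKG : K <| G.
  have [||JE|JE] := maxH (H <*> L)%G.
  - exact: joing_subl.
  - by rewrite join_subG !subsetIl.
  - have sLH : L \subset H by rewrite -JE joing_subr.
    by move: indL; rewrite /K /= (setIidPr sLH) indexgg.
  rewrite /normal -JE join_subG (normal_norm nKH) (normal_norm nKL) andbT.
  by rewrite JE subIset // sHG.
have [KC | trK] := prim_trans_norm primG nKG.
  have K1 : K :=: 1%g.
    apply/trivgP/subsetP => g /(subsetP KC)/setIP[_ /astabP gT].
    by rewrite inE; apply/eqP/permP => y; rewrite perm1; apply: gT.
  by rewrite -cK K1 cards1.
(* If [K] were transitive, this would give [d = x], hence [K = H], against index 2. *)
have Kx : orbit 'P K x = [set x].
  by apply/orbit1P/afixP => g /setIP[/setIP[_ /astab1P]].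
have /setP/(_ d) := atransP trK x (in_setT x).
rewrite Kx !inE => /eqP dx.
by move: indH; rewrite /K /H /L dx /= setIid indexgg.
Qed.

(** * The orbital of a pair of points *)

Section OrbitalRelation.

Variables (T : finType) (G : {group {perm T}}) (x d : T).

Definition orbital : rel T :=
  fun y z => [exists g in G, (g x == y) && (g d == z)].

Lemma orbital_inv g y z : g \in G -> orbital (g y) (g z) = orbital y z.
Proof.
have inv h u w : h \in G -> orbital u w -> orbital (h u) (h w).
  move=> Gh /exists_inP[s Gs /andP[/eqP<- /eqP<-]].
  by apply/exists_inP; exists (s * h)%g; rewrite ?groupM // !permM !eqxx.
move=> Gg; apply/idP/idP => [|]; last exact: inv.
by move/(inv g^-1%g); rewrite !permK; apply; rewrite groupV.
Qed.

Lemma orbital_irr : d != x -> irreflexive orbital.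
Proof.
move=> dx y; apply: contraNF dx => /exists_inP[g _ /andP[/eqP<- /eqP]].
by move/perm_inj->.
Qed.

(** The points related to [x] form the suborbit of [d]; an element taking [x] to [y] carries them to
    those related to [y]. *)
Lemma card_orbital y : [transitive G, on [set: T] | 'P] ->
  #|orbital y| = #|orbit 'P 'C_G[x | 'P]%g d|.
Proof.
move=> trG; have [h Gh ->] := transitive_perm trG x y.
rewrite -[RHS](card_imset _ (@perm_inj _ h)); apply: eq_card => z.
rewrite unfold_in /orbital; apply/exists_inP/imsetP => [[g Gg]|[w /orbitP[s]]].
  case/andP=> /eqP gx /eqP <-; exists ((g * h^-1)%g d); last first.
    by rewrite permM permKV.
  apply/orbitP; exists (g * h^-1)%g => //.
  apply/setIP; split; first by rewrite groupM ?groupV.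
  by apply/astab1P; rewrite /= /aperm permM gx permK.
case/setIP=> Gs /astab1P sx <- ->; exists (s * h)%g; first by rewrite groupM.
by rewrite !permM -[s x]/('P%act x s) sx !eqxx.
Qed.

End OrbitalRelation.

(** * Rank 3 and the subdegrees *)

Lemma type_III_rank (p : nat) (T : finType) (G : {group {perm T}}) x :
  (3 < p)%N -> [transitive G, on [set: T] | 'P] -> type_III G p ->
  #|suborbits G x| = 3.
Proof.
move=> p3 trG [i [j [nij di dj chiE]]].
apply/eqP; rewrite -(eqr_nat algC) -(cfnorm_perm_char trG) chiE -irr0.
(* The degrees 2p and p - 1 differ from 1, so the three constituents are distinct and the norm is
   3. *)
have ni : i != 0.
  by apply: contra_eq_neq di => ->; rewrite irr0 cfun11 eq_sym pnatr_eq1; lia.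
have nj : j != 0.
  by apply: contra_eq_neq dj => ->; rewrite irr0 cfun11 eq_sym pnatr_eq1; lia.
rewrite !cfdotDl !cfdotDr !cfdot_irr !eqxx ![0 == _]eq_sym ![j == i]eq_sym.
rewrite (negbTE ni) (negbTE nj) (negbTE nij) !addr0 !add0r.
by rewrite -!natrD.
Qed.

Theorem theorem9p1 (p : nat) (T : finType) (G : {group {perm T}})
  (p_prime : prime p) (p_ge5 : (5 <= p)%N)
  (degG : #|T| = (3 * p)%N)
  (primG : [primitive G, on [set: T] | 'P])
  (not2trG : ~~ [transitive^2 G, on [set: T] | 'P])
  (typeG : type_III G p) :
  exists a : int,
    p%:Z = 3 * a ^+ 2 + 3 * a + 1 /\
    (has_subdegrees G [:: 1; p%:Z - 2 * a - 1; 2 * p%:Z + 2 * a] \/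
     has_subdegrees G [:: 1; p%:Z + 2 * a + 1; 2 * p%:Z - 2 * a - 2]).
Proof.
have /andP[trG _] := primG.
have p_gt3 : (3 < p)%N by lia.
have [x _] : exists x : T, x \in T by apply/card_gt0P; rewrite degG; lia.
have [d [e []]] := suborbit_sizes_rank3 (type_III_rank x p_gt3 trG typeG).
set k := #|orbit _ _ d|; set l := #|orbit _ _ e| => dx k_gt0 le_kl.
rewrite degG => kl pE.
(* If k = 2, the stabiliser has order 2, but the orbit size l = 3p - 3 must divide that order. *)
have k_neq2 : k != 2.
  apply/eqP => k2; have := dvdn_orbit 'P 'C_G[x | 'P]%G e.
  by rewrite (primitive_suborbit2 primG k2) => /dvdn_leq; rewrite -/l; lia.
have [u [v [tr1 tr2]]] := type_III_eigenvalues p_gt3 degG typeG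
  (@orbital_inv T G x d) (orbital_irr G dx)
  (fun y => card_orbital x d y trG).
have := type_III_arith _ k_gt0 _ k_neq2 tr1 tr2.
case=> [||pu kE]; try lia.
have sizes y : perm_eq [seq n%:Z | n <- suborbit_sizes G y] [:: 1; k%:Z; l%:Z].
  exact: (perm_map _ (perm_trans (perm_suborbit_sizes trG y x) pE)).
have lE : l%:Z = 3 * p%:Z - 1 - k%:Z by lia.
exists u; split=> //; case: kE => kE; [left | right] => y.
  apply: (perm_trans (sizes y)); rewrite lE kE.
  by rewrite (_ : 3 * p%:Z - 1 - _ = 2 * p%:Z + 2 * u); last by ring.
(* In case (ii) k is the last listed value, so the two nontrivial sizes are exchanged. *)
apply: (perm_trans (sizes y)); rewrite lE kE perm_cons.
rewrite (_ : 3 * p%:Z - 1 - _ = p%:Z + 2 * u + 1); last by ring.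
exact: (permEl (perm_catC [:: _] [:: _])).
Qed.
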